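(* Let $m$ be a positive integer, let $\mathbf{z} = (z_1,\ldots,z_m) \in \mathbb{C}^m$, let $\mathbf{a} = (a_1,\ldots,a_m)$ be an $m$-tuple of positive integers with $a_1+\cdots + a_m = n$, and let $\mathbf{J}_{\mathbf{a}} = \mathbf{J}_{\mathbf{a}}(\mathbf{z})$ be the Jacobian matrix at $\mathbf{z}$ of the map $\theta_{\mathbf{a}}\colon\mathbb{C}^m\to\mathbb{C}^m$ defined in the context. The Jacobian determinant factors as \[ \det \mathbf{J}_{\mathbf{a}} = \frac{1}{\binom{n}{a_1,\ldots,a_m}}\left(\prod_{j\in [m]} (-z_j)^{a_j}\right)\left(\prod_{\substack{j,k\in [m] \\ j\neq k}}(z_k-z_j)^{a_j}\right), \] where the last product runs over all ordered pairs $(j,k)$ with $j\neq k$. Thus $\mathbf{J}_{\mathbf{a}}$ is invertible if and only if $z_1,\ldots,z_m$ are distinct and nonzero.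
   Context: For a positive integer $m$, $[m]=\{1,\ldots,m\}$. The multinomial coefficient is $\binom{n}{a_1,\ldots,a_m}=\frac{n!}{a_1!\cdots a_m!}$. For $\mathbf{z}\in\mathbb{C}^m$ and an $m$-tuple $\mathbf{a}$ of positive integers, let $p_{\mathbf{a}}(z)=p_{\mathbf{z},\mathbf{a}}(z)=\int_0^z (w-z_1)^{a_1}\cdots(w-z_m)^{a_m}\,dw$. The map $\theta_{\mathbf{a}}\colon\mathbb{C}^m\to\mathbb{C}^m$ sends $\mathbf{z}$ to $(p_{\mathbf{z},\mathbf{a}}(z_1),\ldots,p_{\mathbf{z},\mathbf{a}}(z_m))$. The Jacobian matrix $\mathbf{J}_{\mathbf{a}}=\mathbf{J}_{\mathbf{a}}(\mathbf{z})$ is the $m\times m$ matrix with $(i,j)$-entry $\frac{\partial}{\partial z_i}p_{\mathbf{a}}(z_j)$, where $p_{\mathbf{a}}(z_j)$ is regarded as a function of all of $z_1,\ldots,z_m$ (both through the coefficients of $p_{\mathbf{z},\mathbf{a}}$ and through the evaluation point). *)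

(* Defs.v *)
From HB Require Import structures.
From mathcomp Require Import all_boot all_order all_algebra.
From mathcomp Require Import complex.
From mathcomp Require Import all_classical all_reals all_analysis.

Set Implicit Arguments.
Unset Strict Implicit.
Unset Printing Implicit Defensive.

Import Order.TTheory GRing.Theory Num.Theory.
Import numFieldNormedType.Exports.

#[global] Open Scope classical_set_scope.
#[global] Open Scope ring_scope.
#[global] Open Scope complex_scope.

(* The complex numbers as a bundled numClosedFieldType: the normed-module
   structure of a numFieldType over itself is inferred for such a bundled
   field, but not for the bare carrier R[i]. *)
Definition Cx (R : realType) : numClosedFieldType := R[i].

(* The line integral of f along the straight segment from u to v, parametrized
   by t |-> u + t (v - u); the real and imaginary parts of the integrand are
   integrated separately.  For an entire f this is the value of the integral
   of f along every path from u to v. *)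
Definition segment_integral (R : realType) (f : Cx R -> Cx R) (u v : Cx R)
    : Cx R :=
  let g (t : R) : Cx R := f (u + t%:C * (v - u)) * (v - u) in
  (\int[lebesgue_measure]_(t in `[0%R, 1%R]) complex.Re (g t))
  +i* (\int[lebesgue_measure]_(t in `[0%R, 1%R]) complex.Im (g t)).

Definition p_fun (R : realType) (m : nat) (a : 'I_m -> nat) (z : 'rV[Cx R]_m)
    (x : Cx R) : Cx R :=
  segment_integral (fun w => \prod_(j < m) (w - z 0 j) ^+ a j) 0 x.

Definition theta (R : realType) (m : nat) (a : 'I_m -> nat) (z : 'rV[Cx R]_m)
    : 'rV[Cx R]_m :=
  \row_(j < m) p_fun a z (z 0 j).

(* Row i, column j: the complex partial derivative in z_i of the j-th component
   of theta.  'D_v f z is a total operator, meaningful only together with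
   derivable f z v. *)
Definition jacobian_theta (R : realType) (m : nat) (a : 'I_m -> nat)
    (z : 'rV[Cx R]_m) : 'M[Cx R]_m :=
  \matrix_(i < m, j < m)
    'D_(delta_mx 0 i) (fun y : 'rV[Cx R]_m => theta a y 0 j) z.

Lemma derive_row_entry (K : numFieldType) (m : nat) (f : 'rV[K]_m -> 'rV[K]_m)
    (z : 'rV[K]_m) (i j : 'I_m) :
  differentiable f z ->
  'D_(delta_mx 0 i) (fun y => f y 0 j) z = jacobian f z i j.
Proof.
move=> df; rewrite [RHS]mxE.
pose c (M : 'rV[K]_m) : K := M 0 j.
have c_lin : linear c by move=> k u v; rewrite /c !mxE.
pose cL : {linear 'rV[K]_m -> K} :=
  HB.pack c (GRing.isLinear.Build _ _ _ _ c c_lin).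
have c_cont : continuous cL by exact: coord_continuous.
have c_diff : differentiable cL (f z) by exact: linear_differentiable.
have -> : (fun y => f y 0 j) = cL \o f by [].
rewrite deriveE; last exact: differentiable_comp.
by rewrite diff_comp // diff_lin.
Qed.

Lemma jacobian_thetaE (R : realType) (m : nat) (a : 'I_m -> nat)
    (z : 'rV[Cx R]_m) :
  differentiable (theta a) z -> jacobian_theta a z = jacobian (theta a) z.
Proof.
by move=> dt; apply/matrixP => i j; rewrite mxE; exact: derive_row_entry.
Qed.

Definition multinomial (F : fieldType) (m n : nat) (a : 'I_m -> nat) : F :=
  n`!%:R / \prod_(j < m) (a j)`!%:R.

(* Main.v *)
Require Import Defs.
From HB Require Import structures.
From mathcomp Require Import all_boot all_order all_algebra.
From mathcomp Require Import complex ring.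
From mathcomp Require Import all_classical all_reals all_analysis.
Import Order.TTheory GRing.Theory Num.Theory.
Import numFieldNormedType.Exports.

(** Write a_j = b_j + 1 and, for a polynomial q, let I_b(q) be the row vector
    whose j-th entry is the integral from 0 to z_j of q(w) prod_k (w - z_k)^b_k.
    Differentiating under the integral sign, the boundary terms vanish because
    the integrand vanishes at every z_j, so row i of the Jacobian matrix is
    - a_i I_b(L_i) with L_i = prod_(k != i) (w - z_k)
    ([jacobian_theta_weighted_integrals]).  Expanding L_i on the monomials
    factors the matrix as
      J = diag(- a_i) * E * M_b,
    where E holds the coefficients of the L_i and M_b has rows I_b(w^k), k < m.

    With V the Vandermonde matrix of z, E * V is diagonal with entries
    prod_(k != i) (z_i - z_k), which gives det E * det V ([det_cofactor_mx]).
    On the other side det M_b is an explicit multiple of det V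
    ([det_moment_mx]), so det J is a multiple of the known product
    det E * det V; the identity is reached without ever dividing by det V and
    so covers coinciding z_j.

    The formula for det M_b is proved by induction on the sum of the exponents.
    Raising b_i by one multiplies every integrand by w - z_i.  The polynomial
    w prod_k (w - z_k)^(b_k + 1) vanishes at 0 and at all z_j, so its
    derivative, which is prod_k (w - z_k)^b_k times a polynomial S of degree m,
    has zero integrals: I_b(S) = 0.  Therefore multiplication by w - z_i acts
    on the I_b(w^k), k < m, as it does on polynomials modulo S, and its
    determinant is the characteristic polynomial of a companion matrix
    evaluated at z_i, i.e. S(z_i) up to sign and leading coefficient
    ([det_mul_subX]).  Since
    S(z_i) = z_i (b_i + 1) prod_(k != i) (z_i - z_k), each step contributes
    exactly the factors that the closed formula predicts. *)

(** * Antiderivatives of polynomials *)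

(** The antiderivative that vanishes at 0: in degree 0 the quotient is a
    division by 0, which is 0. *)
Definition antideriv {F : fieldType} (q : {poly F}) : {poly F} :=
  \poly_(i < (size q).+1) (q`_i.-1 / i%:R).

Lemma coef_antideriv {F : fieldType} (q : {poly F}) i :
  (antideriv q)`_i = q`_i.-1 / i%:R.
Proof.
rewrite coef_poly; case: i => [|i]; first by rewrite invr0 mulr0.
by rewrite ltnS; case: ltnP => // /(nth_default 0) ->; rewrite mul0r.
Qed.

Fact antideriv_is_linear {F : fieldType} : linear (@antideriv F).
Proof.
move=> k p q; apply/polyP => i.
by rewrite coefD coefZ !coef_antideriv coefD coefZ mulrDl mulrA.
Qed.

HB.instance Definition _ (F : fieldType) :=
  GRing.isLinear.Build F {poly F} {poly F} _ (@antideriv F) antideriv_is_linear.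

Lemma horner0_antideriv {F : fieldType} (q : {poly F}) : (antideriv q).[0] = 0.
Proof. by rewrite horner_coef0 coef_antideriv invr0 mulr0. Qed.

Lemma deriv_antideriv {F : numFieldType} (q : {poly F}) :
  (antideriv q)^`() = q.
Proof.
apply/polyP => i.
by rewrite coef_deriv coef_antideriv -[LHS]mulr_natr divfK.
Qed.

Lemma antideriv_deriv {F : numFieldType} (q : {poly F}) :
  antideriv q^`() = q - (q.[0])%:P.
Proof.
apply/polyP => -[|i]; rewrite coef_antideriv coefB coefC /=.
  by rewrite invr0 mulr0 horner_coef0 subrr.
by rewrite subr0 coef_deriv -[X in X / _]mulr_natr mulfK // pnatr_eq0.
Qed.

Lemma antiderivXn {F : fieldType} k :
  antideriv ('X^k : {poly F}) = k.+1%:R^-1 *: 'X^(k.+1).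
Proof.
apply/polyP => -[|i]; rewrite coef_antideriv coefZ !coefXn.
  by rewrite invr0 !mulr0.
by rewrite eqSS /=; case: eqP => [->|_]; rewrite ?mulr1 ?mul1r // mul0r mulr0.
Qed.

(** * Multiplication by a linear polynomial modulo a polynomial *)

(** A linear map that kills p sees only residues modulo p on polynomials of
    degree at most m, so multiplying the basis 'X^k, k < m, by x - 'X acts as
    x minus the companion matrix of p, whose determinant is p(x). *)
Lemma det_mul_subX_monic {F : fieldType} {m : nat}
    (L : {linear {poly F} -> 'rV[F]_m}) (p : {poly F}) (x : F) :
    size p = m.+1 -> p \is monic -> L p = 0 ->
  \det (\matrix_(k < m) L ('X^k * (x%:P - 'X))) =
  p.[x] * \det (\matrix_(k < m) L 'X^k).
Proof.
move=> size_p p_monic Lp.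
have Em : m = (size p).-1 by rewrite size_p.
subst m.
have -> : p.[x] =
    \det (map_mx (horner_eval x) (char_poly_mx (companionmx p))).
  by rewrite det_map_mx -/(char_poly _) companionmxK.
rewrite -det_mulmx.
congr (\det _); apply/row_matrixP => k.
rewrite row_mul rowK mulrBr linearB /= mulrC mul_polyC linearZ /= -exprSr.
have -> : row k (map_mx (horner_eval x) (char_poly_mx (companionmx p))) =
   x *: delta_mx 0 k - row k (companionmx p).
  apply/rowP=> j; rewrite !mxE /=.
  by rewrite [LHS]hornerD hornerN hornerC hornerMn hornerX mulr_natr eq_sym.
rewrite mulmxBl -scalemxAl -rowE rowK; congr (_ - _).
have -> : row k (companionmx p) *m (\matrix_(k0 < (size p).-1) L 'X^k0) =
  \sum_j companionmx p k j *: L 'X^j.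
  by rewrite mulmx_sum_row; apply: eq_bigr => j _; rewrite mxE rowK.
(* The last row produces 'X^m, which L p = 0 expresses by lower powers. *)
have [kE|kN] := eqVneq (k : nat) (size p).-1.-1.
  have E : p = \sum_(j < (size p).-1) p`_j *: 'X^j + 'X^(k.+1).
    have sp : size p = (size p).-1.+1 by rewrite size_p.
    have kS : k.+1 = (size p).-1.
      by rewrite kE prednK // (leq_ltn_trans _ (ltn_ord k)).
    rewrite -{1}[p]coefK poly_def -!(big_mkord xpredT (fun j => p`_j *: 'X^j)).
    rewrite {1}sp big_nat_recr //= kS.
    by rewrite -lead_coefE (monicP p_monic) scale1r.
  have := congr1 L E; rewrite Lp linearD /= linear_sum /= addrC => /esym/eqP.
  rewrite addr_eq0 => /eqP ->; rewrite -sumrN; apply: eq_bigr => j _.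
  by rewrite mxE kE eqxx linearZ scaleNr.
have ltk : (k.+1 < (size p).-1)%N.
  rewrite ltn_neqAle (ltn_ord k) andbT.
  by apply: contra kN => /eqP/(congr1 predn) /= kE; apply/eqP.
rewrite (bigD1 (Ordinal ltk)) //= mxE (negbTE kN) eqxx scale1r big1 ?addr0 //.
move=> j; rewrite -val_eqE /= mxE (negbTE kN) eq_sym => /negbTE ->.
by rewrite scale0r.
Qed.

Lemma det_mul_subX {F : fieldType} {m : nat}
    (L : {linear {poly F} -> 'rV[F]_m}) (p : {poly F}) (x : F) :
    (size p <= m.+1)%N -> p`_m != 0 -> L p = 0 ->
  p`_m * \det (\matrix_(k < m) L ('X^k * (x%:P - 'X))) =
  p.[x] * \det (\matrix_(k < m) L 'X^k).
Proof.
move=> le_p pm0 Lp.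
have size_p : size p = m.+1.
  apply/eqP; rewrite eqn_leq le_p ltnNge.
  by apply: contra pm0 => /(nth_default 0) ->.
rewrite (@det_mul_subX_monic _ _ L ((p`_m)^-1 *: p)).
- by rewrite hornerZ !mulrA divff // mul1r.
- by rewrite size_scale // invr_neq0.
- by rewrite monicE lead_coefZ lead_coefE size_p mulVf.
- by rewrite linearZ /= Lp scaler0.
Qed.

(** * The determinant of the moment matrix *)

Lemma deriv_prod {R : comNzRingType} {I : finType} (p : I -> {poly R}) :
  (\prod_i p i)^`() = \sum_i (p i)^`() * \prod_(j | j != i) p j.
Proof.
elim: (index_enum I) (index_enum_uniq I) => [|x s IH] /=.
  by rewrite !big_nil -polyC1 derivC.
move=> /andP[x_notin s_uniq]; rewrite !big_cons derivM {}IH // eqxx /=.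
congr (_ * _ + _).
  rewrite [RHS]big_seq_cond [LHS]big_seq_cond; apply: eq_bigl => j.
  by rewrite andbT; case: eqP => // [->|_]; rewrite ?(negbTE x_notin) ?andbT.
rewrite mulr_sumr !big_seq; apply: eq_bigr => i i_in.
rewrite big_cons ifT 1?mulrCA //.
by apply: contra x_notin => /eqP ->.
Qed.

Section Moments.
Context {F : numFieldType} {m : nat} (z : 'rV[F]_m).
Implicit Types (b : 'I_m -> nat) (i j k : 'I_m).

Definition root_prod b : {poly F} := \prod_j ('X - (z 0 j)%:P) ^+ b j.

Definition cofactor_poly i : {poly F} := \prod_(j | j != i) ('X - (z 0 j)%:P).

Definition integrals (q : {poly F}) : 'rV[F]_m :=
  \row_j (antideriv q).[z 0 j].

Fact integrals_is_linear : linear integrals.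
Proof.
move=> c p q; apply/rowP => j.
by rewrite !mxE linearP hornerD hornerZ.
Qed.

HB.instance Definition _ :=
  GRing.isLinear.Build F {poly F} 'rV[F]_m _ integrals integrals_is_linear.

Definition incr_at i b j := (b j + (j == i))%N.

Definition weighted_integrals b (q : {poly F}) : 'rV[F]_m :=
  integrals (root_prod b * q).

Fact weighted_integrals_is_linear b : linear (weighted_integrals b).
Proof.
by move=> c p q; rewrite /weighted_integrals mulrDr -scalerAr linearP.
Qed.

HB.instance Definition _ b :=
  GRing.isLinear.Build F {poly F} 'rV[F]_m _ (weighted_integrals b)
    (weighted_integrals_is_linear b).

Definition moment_mx b : 'M[F]_m :=
  \matrix_(k < m) weighted_integrals b 'X^k.

(** The polynomial S such that root_prod b * S is the derivative of
    'X * \prod_j ('X - z_j)^(b_j + 1), see [deriv_mulX_root_prod]. *)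
Definition log_deriv_num b : {poly F} :=
  \prod_j ('X - (z 0 j)%:P)
  + 'X * \sum_i (b i).+1%:R *: cofactor_poly i.

Lemma root_prod_incr i b :
  root_prod (incr_at i b) = ('X - (z 0 i)%:P) * root_prod b.
Proof.
rewrite /root_prod (bigD1 i) //= [X in _ = _ * X](bigD1 i) //= mulrA.
rewrite /incr_at eqxx addn1 exprS; congr (_ * _).
by apply: eq_bigr => j /negbTE ->; rewrite addn0.
Qed.

Lemma cofactor_polyE i : ('X - (z 0 i)%:P) * cofactor_poly i =
  \prod_j ('X - (z 0 j)%:P).
Proof. by rewrite [RHS](bigD1 i). Qed.

Lemma deriv_mulX_root_prod b :
  ('X * root_prod (fun j => (b j).+1))^`() = root_prod b * log_deriv_num b.
Proof.
rewrite derivM derivX mul1r mulrDr; congr (_ + _).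
  by rewrite /root_prod -big_split; apply: eq_bigr => j _; rewrite exprSr.
rewrite mulrCA; congr (_ * _); rewrite deriv_prod mulr_sumr.
apply: eq_bigr => i _; rewrite deriv_exp derivXsubC mul1r /= -mulr_natr.
rewrite -scalerAr -mul_polyC polyC_natr /root_prod [in RHS](bigD1 i) //=.
rewrite (eq_bigr (fun j => ('X - (z 0 j)%:P) ^+ b j * ('X - (z 0 j)%:P)))//.
  by rewrite big_split -!mulrA mulrCA.
by move=> j _; rewrite exprSr.
Qed.

(** The factor 'X makes the differentiated polynomial vanish at 0 as well as at
    the z_j, that is at both ends of every path of integration. *)
Lemma weighted_integrals_log_deriv_num b :
  weighted_integrals b (log_deriv_num b) = 0.
Proof.
apply/rowP => j; rewrite !mxE -deriv_mulX_root_prod antideriv_deriv.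
rewrite hornerD hornerN hornerC !hornerM !hornerX mul0r subr0 /root_prod.
rewrite (bigD1 j) //= hornerM horner_exp hornerXsubC subrr.
by rewrite exprS !mul0r mulr0.
Qed.

Lemma monic_cofactor_poly i : cofactor_poly i \is monic.
Proof. by apply: monic_prod => j _; rewrite monicXsubC. Qed.

Lemma size_prod_XsubC_ord : size (\prod_j ('X - (z 0 j)%:P)) = m.+1.
Proof. by rewrite size_prod_XsubC /index_enum unlock -enumT size_enum_ord. Qed.

Lemma size_cofactor_poly i : size (cofactor_poly i) = m.
Proof.
have := size_prod_XsubC_ord.
rewrite -(cofactor_polyE i) size_monicM ?monicXsubC //.
  by rewrite size_XsubC /= => -[].
exact/monic_neq0/monic_cofactor_poly.
Qed.

Lemma size_log_deriv_num b : (size (log_deriv_num b) <= m.+1)%N.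
Proof.
apply: (leq_trans (size_polyD _ _)).
rewrite geq_max size_prod_XsubC_ord leqnn /=.
rewrite mulrC (leq_trans (size_polyMleq _ _)) // size_polyX addn2 /= ltnS.
apply: (leq_trans (size_sum _ _ _)); apply/bigmax_leqP => i _.
by rewrite (leq_trans (size_scale_leq _ _)) // size_cofactor_poly.
Qed.

Lemma coef_log_deriv_num b :
  (log_deriv_num b)`_m = (m + \sum_j b j).+1%:R.
Proof.
have lcE (p : {poly F}) (k : nat) : p \is monic -> size p = k.+1 -> p`_k = 1.
  by move=> /monicP <- sp; rewrite lead_coefE sp.
rewrite coefD lcE ?size_prod_XsubC_ord //; last exact: monic_prod_XsubC.
rewrite mulr_sumr coef_sum -natr1 natrD natr_sum addrC; congr (_ + _).
have -> : m%:R = \sum_(i < m) 1 :> F by rewrite sumr_const card_ord.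
rewrite -big_split /=; apply: eq_bigr => i _.
rewrite -scalerAr coefZ lcE ?mulr1 ?[RHS]nat1r //.
  by rewrite monicMl ?monicX ?monic_cofactor_poly.
rewrite size_monicM ?monicX ?size_polyX ?size_cofactor_poly //.
exact/monic_neq0/monic_cofactor_poly.
Qed.

Lemma horner_log_deriv_num b i :
  (log_deriv_num b).[z 0 i] =
  z 0 i * (b i).+1%:R * \prod_(j | j != i) (z 0 i - z 0 j).
Proof.
rewrite hornerD -(cofactor_polyE i) hornerM hornerXsubC subrr mul0r add0r.
rewrite hornerM hornerX -mulrA; congr (_ * _).
rewrite horner_sum (bigD1 i) //= big1 ?addr0 => [|k ki].
  by rewrite hornerZ horner_prod; under eq_bigr do rewrite hornerXsubC.
rewrite hornerZ horner_prod (bigD1 i) /= ?hornerXsubC; last by rewrite eq_sym.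
by rewrite subrr mul0r mulr0.
Qed.

(** [det_mul_subX] with p = log_deriv_num b and x = z_i: raising b_i
    multiplies the weight by 'X - z_i. *)
Lemma det_moment_mx_incr_at b i :
  (m + \sum_j b j).+1%:R * \det (moment_mx (incr_at i b)) =
  (b i).+1%:R * - z 0 i * \prod_(j | j != i) (z 0 j - z 0 i)
  * \det (moment_mx b).
Proof.
have := @det_mul_subX _ _ (weighted_integrals b) _ (z 0 i)
  (size_log_deriv_num b) _ (weighted_integrals_log_deriv_num b).
rewrite coef_log_deriv_num pnatr_eq0 => /(_ isT).
rewrite horner_log_deriv_num.
have -> : \matrix_(k < m) weighted_integrals b ('X^k * ((z 0 i)%:P - 'X)) =
   - moment_mx (incr_at i b).
  apply/row_matrixP => k; rewrite linearN /= !rowK /weighted_integrals.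
  by rewrite -linearN root_prod_incr; congr integrals; ring.
rewrite -scaleN1r detZ.
(* The sign (-1)^m turns z_i into - z_i and flips the m - 1 differences. *)
have sgnE : (-1) ^+ m * \prod_(j | j != i) (z 0 i - z 0 j) =
    - \prod_(j | j != i) (z 0 j - z 0 i).
  rewrite -{1}(card_ord m) -prodr_const (bigD1 i) //= -mulrA -big_split mulN1r.
  by congr (- _); apply: eq_bigr => j _; rewrite /= mulN1r opprB.
move=> /(congr1 ( *%R ((-1) ^+ m))).
rewrite mulrCA signrMK => ->; rewrite mulrA [in LHS]mulrCA sgnE.
by rewrite /moment_mx; ring.
Qed.

(** With all exponents 0 the entries are z_j^(k+1) / (k+1), a Vandermonde
    matrix with scaled rows and columns. *)
Lemma det_moment_mx0 :
  \det (moment_mx (fun=> 0%N)) * m`!%:R =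
  (\prod_j z 0 j) * \det (Vandermonde m z).
Proof.
pose d : 'rV[F]_m := \row_k (k.+1%:R^-1)%R.
have -> : moment_mx (fun=> 0%N) = diag_mx d *m Vandermonde m z *m diag_mx z.
  rewrite mul_mx_diag mul_diag_mx; apply/matrixP => k j; rewrite !mxE.
  rewrite /root_prod big1 ?mul1r => [|l _]; last exact: expr0.
  by rewrite antiderivXn hornerZ hornerXn exprSr mulrA.
have d_fact : (\prod_k d 0 k) * m`!%:R = 1.
  rewrite fact_prod natr_prod big_add1 big_mkord -big_split big1 //= => k _.
  by rewrite mxE mulVf // pnatr_eq0.
by rewrite !det_mulmx !det_diag -[RHS]mul1r -[X in _ = X * _]d_fact; ring.
Qed.

(** Peels off one unit of exponent at a time with [det_moment_mx_incr_at]; the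
    prefactors b_i + 1 and m + \sum_j b_j + 1 build up the factorials. *)
Lemma det_moment_mx b :
  \det (moment_mx b) * (m + \sum_j b j)`!%:R =
  (\prod_j (b j)`!%:R)
  * (\prod_i (- z 0 i * \prod_(j | j != i) (z 0 j - z 0 i)) ^+ b i)
  * ((\prod_j z 0 j) * \det (Vandermonde m z)).
Proof.
have [s] := ubnP (\sum_j b j); elim: s b => // s IH b le_s.
have [b0|] := boolP [forall j, b j == 0%N].
  have -> : b = fun=> 0%N by apply/funext => j; apply/eqP/(forallP b0).
  rewrite big1 // addn0 det_moment_mx0 [X in _ = X * _ * _]big1 //.
  by rewrite [X in _ = _ * X * _]big1 // !mul1r.
rewrite negb_forall; case/existsP => i; rewrite -lt0n => bi_gt0.
pose b' j := (b j - (j == i))%N.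
have bE : b = incr_at i b'.
  by apply/funext => j; rewrite /incr_at subnK //; case: eqP => // ->.
have sumE : (\sum_j b j = (\sum_j b' j).+1)%N.
  rewrite {1}bE big_split /= -addn1; congr (_ + _)%N.
  by rewrite (bigD1 i) //= eqxx big1 // => j /negbTE ->.
rewrite sumE ltnS in le_s.
rewrite sumE addnS factS natrM mulrCA mulrA {1}bE det_moment_mx_incr_at.
rewrite -[LHS]mulrA IH // {le_s IH sumE} bE !mulrA; congr (_ * _ * _).
have -> : \prod_j (incr_at i b' j)`!%:R =
    (b' i).+1%:R * \prod_j (b' j)`!%:R :> F.
  rewrite (bigD1 i) //= [in RHS](bigD1 i) //= mulrA -natrM -factS.
  rewrite /incr_at eqxx addn1; congr (_ * _).
  by apply: eq_bigr => j /negbTE ->; rewrite addn0.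
have prodX_incr_at (w : 'I_m -> F) :
    \prod_j w j ^+ incr_at i b' j = w i * \prod_j w j ^+ b' j.
  rewrite (bigD1 i) //= [in RHS](bigD1 i) //= mulrA -exprS.
  rewrite /incr_at eqxx addn1; congr (_ * _).
  by apply: eq_bigr => j /negbTE ->; rewrite addn0.
rewrite (prodX_incr_at
  (fun i => - z 0 i * \prod_(j | j != i) (z 0 j - z 0 i))).
by ring.
Qed.

(** * From moments to the cofactor basis *)

Definition cofactor_mx : 'M[F]_m := \matrix_(i, k) (cofactor_poly i)`_k.

(** Entry (i, j) of the product is the value at z_j of
    \prod_(k != i) ('X - z_k), which vanishes unless i = j. *)
Lemma det_cofactor_mx :
  \det cofactor_mx * \det (Vandermonde m z) =
  \prod_i \prod_(j | j != i) (z 0 i - z 0 j).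
Proof.
rewrite -det_mulmx.
have -> : cofactor_mx *m Vandermonde m z =
    diag_mx (\row_i \prod_(j | j != i) (z 0 i - z 0 j)).
  apply/matrixP => i j; rewrite !mxE.
  have -> : \sum_k cofactor_mx i k * Vandermonde m z k j =
      (cofactor_poly i).[z 0 j].
    rewrite (@horner_coef_wide _ m) ?size_cofactor_poly //.
    by apply: eq_bigr => k _; rewrite !mxE.
  rewrite horner_prod; under eq_bigr do rewrite hornerXsubC.
  have [->|ij] := eqVneq; first by rewrite mulr1n.
  by rewrite (bigD1 j) 1?eq_sym //= subrr mul0r.
by rewrite det_diag; apply: eq_bigr => i _; rewrite mxE.
Qed.

Lemma weighted_integrals_cofactor b :
  \matrix_i weighted_integrals b (cofactor_poly i) = cofactor_mx *m moment_mx b.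
Proof.
apply/row_matrixP => i; rewrite row_mul rowK mulmx_sum_row.
rewrite -{1}[cofactor_poly i]coefK size_cofactor_poly poly_def linear_sum /=.
by apply: eq_bigr => k _; rewrite !mxE rowK linearZ.
Qed.

(** The Vandermonde determinant contained in [det_moment_mx] is absorbed by the
    determinant of [cofactor_mx], so the formula also holds when some of the
    z_j coincide. *)
Lemma det_scaled_weighted_integrals b :
  \det (\matrix_i (- (b i).+1%:R *: weighted_integrals b (cofactor_poly i)))
  * (\sum_j (b j).+1)%N`!%:R =
  \prod_j (b j).+1`!%:R * \prod_j (- z 0 j) ^+ (b j).+1
  * \prod_i \prod_(j | j != i) (z 0 j - z 0 i) ^+ (b i).+1.
Proof.
have -> : \matrix_i (- (b i).+1%:R *: weighted_integrals b (cofactor_poly i)) =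
    diag_mx (\row_i (- (b i).+1%:R : F)) *m (cofactor_mx *m moment_mx b).
  rewrite -weighted_integrals_cofactor; apply/row_matrixP => i.
  by rewrite row_mul row_diag_mx -scalemxAl -rowE !rowK mxE.
have -> : (\sum_j (b j).+1 = m + \sum_j b j)%N.
  by under eq_bigr do rewrite -add1n; rewrite big_split /= sum1_card card_ord.
rewrite !det_mulmx det_diag -!mulrA det_moment_mx.
have swapE : \prod_i \prod_(j | j != i) (z 0 i - z 0 j) =
    \prod_i \prod_(j | j != i) (z 0 j - z 0 i).
  rewrite (exchange_big_dep predT) //=.
  by apply: eq_bigr => i _; apply: eq_bigl => j; rewrite eq_sym.
have factE : (\prod_i - (b i).+1%:R) * \prod_j (b j)`!%:R =
    (\prod_j (b j).+1`!%:R) * \prod_(j : 'I_m) (-1) :> F.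
  by rewrite -!big_split; apply: eq_bigr => j _; rewrite /= factS natrM; ring.
have signE : (\prod_(j < m) (-1)) * \prod_j z 0 j = \prod_j - z 0 j.
  by rewrite -big_split; apply: eq_bigr => j _; rewrite /= mulN1r.
have powE : (\prod_j - z 0 j)
    * (\prod_i (- z 0 i * \prod_(j | j != i) (z 0 j - z 0 i)) ^+ b i)
    * (\prod_i \prod_(j | j != i) (z 0 j - z 0 i)) =
    \prod_j (- z 0 j) ^+ (b j).+1
    * \prod_i \prod_(j | j != i) (z 0 j - z 0 i) ^+ (b i).+1.
  rewrite -!big_split; apply: eq_bigr => j _ /=.
  by rewrite exprMn prodrXl !exprS; ring.
rewrite -powE -signE -swapE -det_cofactor_mx.
rewrite (eq_bigr (fun i => - (b i).+1%:R)) => [|i _]; last by rewrite mxE.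
set W := \prod_i _ ^+ _; set B := \prod_j (b j)`!%:R; set C := \prod_i - _.
rewrite -/B -/C in factE.
transitivity (C * B * ((\prod_j z 0 j) * W
    * (\det cofactor_mx * \det (Vandermonde m z)))); first by ring.
by rewrite factE; ring.
Qed.

End Moments.

(** * Segment integrals of polynomials *)

Lemma Rintegral_horner_deriv {R : realType} (p : {poly R}) :
  \int[lebesgue_measure]_(t in `[0%R, 1%R]) p^`().[t] = p.[1] - p.[0].
Proof.
rewrite /Rintegral (@continuous_FTC2 _ _ (horner p)) //.
- by apply: continuous_subspaceT; exact: continuous_horner.
- split=> [t _| |]; first exact: derivable_horner.
  + by apply: cvg_at_right_filter; exact: continuous_horner.
  + by apply: cvg_at_left_filter; exact: continuous_horner.
- by move=> t _; rewrite derivE.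
Qed.

(** Applied to phi the real or the imaginary part, this turns the integrand of
    a segment integral into a real polynomial in the parameter. *)
Lemma horner_map_realscaled {R : realType} (phi : {additive Cx R -> R})
    (phiZ : forall (t : R) (x : Cx R), phi (x * t%:C) = phi x * t)
    (p : {poly Cx R}) (t : R) :
  phi p.[t%:C] = (map_poly phi p).[t].
Proof.
elim/poly_ind: p => [|p c IH]; first by rewrite raddf0 !horner0 raddf0.
rewrite hornerMXaddC raddfD phiZ IH.
rewrite raddfD /= map_polyC /= hornerD hornerC; congr (_ + _).
rewrite -[LHS]hornerMX; congr (_.[t]); apply/polyP => -[|i].
  by rewrite coef_map !coefMX /= raddf0.
by rewrite coef_map !coefMX coef_map.
Qed.

Lemma deriv_map_additive {R S : nzRingType} (phi : {additive R -> S})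
    (p : {poly R}) : (map_poly phi p)^`() = map_poly phi p^`().
Proof. by apply/polyP => i; rewrite coef_map !coef_deriv coef_map raddfMn. Qed.

Lemma segment_integral_horner_deriv {R : realType} (p : {poly Cx R})
    (u v : Cx R) :
  segment_integral (horner p^`()) u v = p.[v] - p.[u].
Proof.
pose q := p \Po (u%:P + (v - u) *: 'X).
have qE (t : R) : p^`().[u + t%:C * (v - u)] * (v - u) = q^`().[t%:C].
  rewrite deriv_comp derivD derivC add0r derivZ derivX.
  rewrite !(hornerE, horner_comp) /= mulr1.
  by rewrite [t%:C * _]mulrC.
have partE (phi : {additive Cx R -> R}) :
    (forall (t : R) (x : Cx R), phi (x * t%:C) = phi x * t) ->
    \int[lebesgue_measure]_(t in `[0%R, 1%R])
      phi (p^`().[u + t%:C * (v - u)] * (v - u)) = phi (p.[v] - p.[u]).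
  move=> phiZ.
  under eq_Rintegral do
    rewrite qE (horner_map_realscaled _ phiZ) -deriv_map_additive.
  rewrite Rintegral_horner_deriv -!(horner_map_realscaled _ phiZ).
  rewrite -raddfB !horner_comp !hornerE /=.
  by rewrite [u + v]addrC addrK.
rewrite /segment_integral (partE (@complex.Re R)); last by move=> t [x y]; simpc.
rewrite (partE (@complex.Im R)); last by move=> t [x y]; simpc.
by case: (_ - _).
Qed.

Lemma p_funE {R : realType} {m : nat} (a : 'I_m -> nat) (y : 'rV[Cx R]_m) x :
  p_fun a y x = (antideriv (root_prod y a)).[x].
Proof.
have -> : p_fun a y x =
    segment_integral (horner (antideriv (root_prod y a))^`()) 0 x.
  rewrite /p_fun deriv_antideriv; congr segment_integral; apply/funext => w.
  rewrite horner_prod; apply: eq_bigr => j _.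
  by rewrite horner_exp hornerXsubC.
by rewrite segment_integral_horner_deriv horner0_antideriv subr0.
Qed.

(** * The partial derivatives of theta *)

Lemma is_derive_horner {F : numFieldType} (p : {poly F}) (x : F) :
  is_derive x 1 (horner p) p^`().[x].
Proof.
elim/poly_ind: p => [|p c IH].
  rewrite (_ : horner 0 = cst 0) ?deriv0 ?horner0; last first.
    by apply/funext => t; rewrite horner0.
  exact: is_derive_cst.
rewrite (_ : horner _ = (horner p * id) + cst c); last first.
  by apply/funext => t; rewrite hornerMXaddC.
apply: is_derive_eq.
rewrite derivD derivC addr0 derivM derivX mulr1 !hornerE /=.
by rewrite addrC /GRing.scale /= mulr1 mulrC.
Qed.

(** Leibniz rule for \int_0^(c + h d) Q(h, w) dw at h = 0, where the outer
    variable of Q is h and the inner one is w.  Since Q is a polynomial in h,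
    it reduces by induction to the product rule, with no passage to the limit
    under the integral. *)
Lemma is_derive_antideriv_horner {F : numFieldType} (Q : {poly {poly F}})
    (c d : F) :
  is_derive (0 : F) 1 (fun h => (antideriv Q.[h%:P]).[c + h * d])
    (d * Q.[0].[c] + (antideriv Q^`().[0]).[c]).
Proof.
elim/poly_ind: Q => [|Q p IH].
  rewrite (_ : (fun _ => _) = cst 0); last first.
    by apply/funext => h; rewrite horner0 raddf0 horner0.
  by rewrite deriv0 !horner0 raddf0 horner0 mulr0 addr0; exact: is_derive_cst.
pose s := c%:P + d *: 'X.
rewrite (_ : (fun _ => _) =
  (fun h => (antideriv Q.[h%:P]).[c + h * d]) * id
  + horner (antideriv p \Po s)); last first.
  apply/funext => h; rewrite hornerMXaddC raddfD hornerD /=.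
  rewrite mulrC mul_polyC linearZ hornerZ mulrC /= [LHS]/=.
  by congr (_ + _); rewrite horner_comp !hornerE mulrC.
have p_der := is_derive_horner (antideriv p \Po s) 0.
apply: is_derive_eq.
rewrite scale0r addr0 mul0r addr0 deriv_comp deriv_antideriv.
rewrite derivD derivC add0r derivZ derivX alg_polyC hornerM hornerC horner_comp.
rewrite derivD derivC addr0 derivM derivX mulr1 !hornerE.
by rewrite /GRing.scale /= mulr1 addrC mulrC.
Qed.

Lemma is_derive_along {F : numFieldType} {V : normedModType F}
    (f : V -> F) (z v : V) (g : F -> F) (df : F) :
    (forall h, f (h *: v + z) = g h) -> is_derive (0 : F) 1 g df ->
  is_derive z v f df.
Proof.
move=> fg [g_derivable <-].
have eq_quot : (fun h : F => h^-1 *: ((f \o shift z) (h *: v) - f z)) =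
    (fun h : F => h^-1 *: ((g \o shift 0) (h *: 1) - g 0)).
  apply/funext => h; rewrite /= addr0 -fg /GRing.scale /= mulr1.
  congr (_ * (_ - _)).
  by rewrite -fg scale0r add0r.
by split; rewrite /derivable /derive eq_quot.
Qed.

(** Moving z_i changes the integrand through the factor ('X - z_i)^(b_i + 1),
    and changes the endpoint z_j when i = j; the endpoint contributes the value
    of the integrand at z_j, which is 0. *)
Lemma is_derive_theta {R : realType} {m : nat} (b : 'I_m -> nat)
    (z : 'rV[Cx R]_m) (i j : 'I_m) :
  is_derive z (delta_mx 0 i)
    (fun y : 'rV[Cx R]_m => theta (fun k => (b k).+1) y 0 j)
    (- (b i).+1%:R * weighted_integrals z b (cofactor_poly z i) 0 j).
Proof.
pose a k := (b k).+1.
pose q := \prod_(k | k != i) ('X - (z 0 k)%:P) ^+ a k.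
(* The outer variable is the displacement of z_i. *)
pose Q : {poly {poly Cx R}} := (('X - (z 0 i)%:P)%:P - 'X) ^+ a i * q%:P.
apply: (is_derive_along _ _ _ (fun h =>
    (antideriv Q.[h%:P]).[z 0 j + h * (i == j)%:R])) => [h|].
  rewrite mxE p_funE !mxE eqxx /= addrC eq_sym; congr ((antideriv _).[_]).
  rewrite /Q !hornerE ?horner_exp ?hornerE /root_prod (bigD1 i) //=.
  congr (_ ^+ _ * _).
    by rewrite !mxE !eqxx mulr1 polyCD opprD addrA addrAC.
  apply: eq_bigr => k /negbTE ki.
  by rewrite !mxE ki andbF mulr0 add0r.
apply: is_derive_eq.
  exact: is_derive_antideriv_horner.
have -> : Q.[0] = root_prod z a.
  by rewrite /Q !hornerE subr0 /root_prod (bigD1 i).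
have -> : (root_prod z a).[z 0 j] = 0.
  by rewrite /root_prod (bigD1 j) //= hornerM horner_exp hornerXsubC subrr
    exprS !mul0r.
have -> : Q^`().[0] = - (b i).+1%:R *: (root_prod z b * cofactor_poly z i).
  rewrite /Q derivM derivC mulr0 addr0 deriv_exp derivB derivC derivX sub0r.
  rewrite mulN1r mulNrn hornerM hornerN hornerMn hornerC horner_exp.
  rewrite !hornerE subr0 scaleNr scaler_nat mulNr mulrnAl; congr (- (_ *+ _)).
  rewrite /root_prod [in RHS](bigD1 i) //= -mulrA; congr (_ * _).
  by rewrite -big_split; apply: eq_bigr => k _; rewrite exprSr.
by rewrite mulr0 add0r linearZ hornerZ mxE.
Qed.

Lemma jacobian_theta_weighted_integrals {R : realType} {m : nat}
    (b : 'I_m -> nat) (z : 'rV[Cx R]_m) :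
  jacobian_theta (fun k => (b k).+1) z =
  \matrix_i (- (b i).+1%:R *: weighted_integrals z b (cofactor_poly z i)).
Proof.
apply/matrixP => i j; rewrite !mxE.
by have [_ ->] := is_derive_theta b z i j; rewrite !mxE.
Qed.

(** * The Jacobian determinant *)

Theorem theoremB (R : realType) (m n : nat) (m_gt0 : (0 < m)%N)
    (z : 'rV[Cx R]_m) (a : 'I_m -> nat)
    (a_gt0 : forall j, (0 < a j)%N) (sum_a : (\sum_(j < m) a j)%N = n) :
  [/\ forall i j : 'I_m,
        derivable (fun y : 'rV[Cx R]_m => theta a y 0 j) z (delta_mx 0 i),
      \det (jacobian_theta a z) =
        (multinomial (Cx R) n a)^-1
        * (\prod_(j < m) (- z 0 j) ^+ a j)
        * (\prod_(jk : 'I_m * 'I_m | jk.1 != jk.2)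
             (z 0 jk.2 - z 0 jk.1) ^+ a jk.1)
    & jacobian_theta a z \in unitmx <->
        injective (fun j : 'I_m => z 0 j) /\ (forall j : 'I_m, z 0 j != 0)].
Proof.
have [b aE] : exists b : 'I_m -> nat, a = fun j => (b j).+1.
  by exists (fun j => (a j).-1); apply/funext => j; rewrite prednK.
rewrite {}aE {a a_gt0} in sum_a *.
have natr_neq0 k : k`!%:R != 0 :> Cx R by rewrite pnatr_eq0 -lt0n fact_gt0.
have prod_fact_neq0 : \prod_(j < m) (b j).+1`!%:R != 0 :> Cx R.
  by apply/prodf_neq0 => j _.
have detE : \det (jacobian_theta (fun j => (b j).+1) z) =
    (multinomial (Cx R) n (fun j => (b j).+1))^-1
    * (\prod_(j < m) (- z 0 j) ^+ (b j).+1)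
    * (\prod_(jk : 'I_m * 'I_m | jk.1 != jk.2)
             (z 0 jk.2 - z 0 jk.1) ^+ (b jk.1).+1).
  apply: (mulIf (natr_neq0 n)).
  rewrite -{1}sum_a jacobian_theta_weighted_integrals.
  rewrite det_scaled_weighted_integrals.
  rewrite pair_big_dep [X in _ * X](eq_bigl (fun jk => jk.1 != jk.2)) /=;
    last first.
    by move=> jk; rewrite eq_sym.
  by rewrite /multinomial invf_div; field.
split=> //.
  by move=> i j; have [] := is_derive_theta b z i j.
rewrite unitmxE detE unitfE !mulf_eq0 !negb_or invr_eq0 mulf_eq0 negb_or.
rewrite natr_neq0 invr_eq0 prod_fact_neq0 /=.
split=> [/andP[/prodf_neq0 z_neq0 /prodf_neq0 z_inj]|[z_inj z_neq0]].
  split=> [j k jk|j]; last first.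
    by have := z_neq0 j isT; rewrite expf_eq0 oppr_eq0.
  apply/eqP/negP => /negP jNk; have := z_inj (j, k) jNk.
  by rewrite /= jk subrr expf_eq0 eqxx.
apply/andP; split; apply/prodf_neq0.
  by move=> j _; rewrite expf_neq0 // oppr_eq0.
move=> [j k] /= jk; rewrite expf_neq0 // subr_eq0.
by apply: contra jk => /eqP/z_inj ->.
Qed.
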